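(* Let $A$ be a C*-algebra. For all $\varepsilon>0$ there is a $\delta>0$ such that, for all $a,b\in A^1_+$, if $(\ll\circ\,\mathbf{d}\,\circ\ll)(a,b)<\delta$, then $\mathbf{u}(a,b)<\varepsilon$.
   Context: $A^1_+$ denotes the set of positive elements of $A$ of norm at most $1$. $\widetilde{A}$ is the unitization of $A$ if $A$ is not unital, and $\widetilde A=A$ otherwise. For elements $a,b$, $a\ll b$ means $a=ab$, and for $\delta>0$, $a\ll_\delta b$ means $\mathbf{d}(a,b)<\delta$, where $\mathbf{d}(a,b)=\|a-ab\|$. Define $$(\ll\circ\,\mathbf{d}\,\circ\ll)(a,b)=\inf\{\delta>0:\ \exists\, c,d\in A^1_+\ \ a\ll c\ll_\delta d\ll b\},$$ $$\mathbf{u}(a,b)=\inf\{\|1-u\|:\ u\in\widetilde{A},\ u^*u=1=uu^*,\ u^*au\ll b\},$$ with $\inf\emptyset=\infty$. *)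

(* Defs.v *)
From HB Require Import structures.
From mathcomp Require Import all_boot all_order all_algebra complex.
From mathcomp Require Import all_classical all_reals all_analysis.

Set Implicit Arguments.
Unset Strict Implicit.
Unset Printing Implicit Defensive.

Import Order.TTheory GRing.Theory Num.Theory.
Import numFieldNormedType.Exports.
Local Open Scope classical_set_scope.
Local Open Scope complex_scope.
Local Open Scope ring_scope.

(* No unit is assumed, and the zero algebra is allowed. *)
HB.mixin Record isCStarAlg (R : realType) A of CompleteNormedModule R[i] A := {
  cmul : A -> A -> A;
  cstar : A -> A;
  cmulA : associative cmul;
  cmulDl : left_distributive cmul +%R;
  cmulDr : right_distributive cmul +%R;
  cmulZl : forall (k : R[i]) (x y : A), cmul (k *: x) y = k *: cmul x y;
  cmulZr : forall (k : R[i]) (x y : A), cmul x (k *: y) = k *: cmul x y;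
  cstarK : involutive cstar;
  cstarD : {morph cstar : x y / x + y};
  cstarZ : forall (k : R[i]) (x : A), cstar (k *: x) = conjc k *: cstar x;
  cstarM : forall x y : A, cstar (cmul x y) = cmul (cstar y) (cstar x);
  cnormM : forall x y : A, `|cmul x y| <= `|x| * `|y|;
  cnorm_star : forall x : A, `|cmul (cstar x) x| = `|x| ^+ 2
}.

#[short(type="cstarAlgType")]
HB.structure Definition CStarAlg (R : realType) :=
  {A of isCStarAlg R A & CompleteNormedModule R[i] A}.

Section CStarAlgDefs.
Variables (R : realType) (A : cstarAlgType R).
Implicit Types a b x y : A.

(* The library norm of a complex normed space takes its values in R[i]. *)
Definition cnorm x : R := complex.Re `|x|.

Definition posball1 : set A :=
  [set a | (exists x, a = cmul (cstar x) x) /\ cnorm a <= 1].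

Definition is_unit (e : A) : Prop := forall x, cmul e x = x /\ cmul x e = x.

Definition ll a b : Prop := a = cmul a b.

Definition dll a b : R := cnorm (a - cmul a b).

Definition ll_d_ll a b : \bar R :=
  ereal_inf [set delta%:E | delta in [set delta : R | 0 < delta /\
    exists c d, [/\ posball1 c, posball1 d, ll a c, dll c d < delta & ll d b]]].

(* A unital normed *-algebra, as raw data, into which A is mapped. *)
Record tilde := Tilde {
  tcar :> zmodType;
  tmul : tcar -> tcar -> tcar;
  tone : tcar;
  tstar : tcar -> tcar;
  tnorm : tcar -> R;
  temb : A -> tcar }.

Definition tilde_unital (e : A) : tilde :=
  {| tcar := A; tmul := @cmul R A; tone := e; tstar := @cstar R A;
     tnorm := cnorm; temb := id |}.

(* (x, k) stands for x + k1; its norm is the operator norm of left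
   multiplication on A, which is the C*-norm when A is not unital. *)
Definition unitz_mul (p q : A * R[i]) : A * R[i] :=
  (cmul p.1 q.1 + p.2 *: q.1 + q.2 *: p.1, p.2 * q.2).

Definition unitz_star (p : A * R[i]) : A * R[i] := (cstar p.1, conjc p.2).

Definition unitz_norm (p : A * R[i]) : R :=
  sup [set cnorm (cmul p.1 y + p.2 *: y) | y in [set y : A | cnorm y <= 1]].

Definition tilde_nonunital : tilde :=
  {| tcar := (A * R[i])%type; tmul := unitz_mul; tone := (0, 1);
     tstar := unitz_star; tnorm := unitz_norm; temb := fun x => (x, 0) |}.

Definition Atilde : tilde :=
  match pselect (exists e : A, is_unit e) with
  | left unitalA => tilde_unital (projT1 (cid unitalA))
  | right _ => tilde_nonunital
  end.

Definition unitary (u : Atilde) : Prop :=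
  tmul (tstar u) u = tone Atilde /\ tmul u (tstar u) = tone Atilde.

(* u^* a u << b is read in the unitization, which contains A as an ideal. *)
Definition udist a b : \bar R :=
  ereal_inf [set (tnorm (tone Atilde - u))%:E | u in [set u : Atilde |
    unitary u /\
    let uau := tmul (tmul (tstar u) (temb Atilde a)) u in
    uau = tmul uau (temb Atilde b)]].

End CStarAlgDefs.

(* Main.v *)
(* Put D = dcd, so that D << b and e = D - c is small.  If
   1 + x = D X + Y (1 - c), then (1 + x) a = D X a, which b fixes; it remains
   to find such an x, small and with (1 + x)^*(1 + x) = 1, and to take
   u = (1 + x)^*.  The choice X = 1 + 2t - tc, Y = 1 + t - ct gives
   x = e + t + (ct - tc) + e(2t - tc), which for self-adjoint t satisfies
   x + x^* = 2(e + t) + e(2t - tc) + (e(2t - tc))^*.  Hence unitarity reads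
   t = - e - (W t + (W t)^* + x^*x)/2 with W t = e(2t - tc), and the right-hand
   side is self-adjoint and a contraction on the ball of radius 2 ||e||.  No
   functional calculus is needed. *)
Require Import Defs.
From mathcomp Require Import all_boot all_order all_algebra complex lra.
From mathcomp Require Import all_classical all_reals all_analysis.

Set Implicit Arguments.
Unset Strict Implicit.
Unset Printing Implicit Defensive.

Import Order.TTheory GRing.Theory Num.Theory.
Import numFieldNormedType.Exports.
Local Open Scope classical_set_scope.
Local Open Scope complex_scope.
Local Open Scope ring_scope.

(** * Arithmetic of the real-valued norm, the product and the involution *)

Section CNorm.
Variables (R : realType) (A : cstarAlgType R).
Implicit Types x y z : A.

Lemma cnormE x : (cnorm x)%:C = `|x|.
Proof. by rewrite RRe_real// normr_real. Qed.

Lemma cnorm_lt x (e : R) : (cnorm x < e) = (`|x| < e%:C).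
Proof. by rewrite -cnormE ltcR. Qed.

Lemma cnorm_ge0 x : 0 <= cnorm x.
Proof. by rewrite -lecR cnormE normr_ge0. Qed.

Lemma cnorm0 : cnorm (0 : A) = 0.
Proof. by rewrite /cnorm normr0. Qed.

Lemma cnorm_eq0 x : cnorm x = 0 -> x = 0.
Proof. by move=> x0; apply/normr0_eq0; rewrite -cnormE x0. Qed.

Lemma cnormD x y : cnorm (x + y) <= cnorm x + cnorm y.
Proof. by rewrite -lecR rmorphD /= !cnormE ler_normD. Qed.

Lemma cnormN x : cnorm (- x) = cnorm x.
Proof. by rewrite /cnorm normrN. Qed.

Lemma cnormB x y : cnorm (x - y) <= cnorm x + cnorm y.
Proof. by rewrite -(cnormN y) cnormD. Qed.

Lemma cnorm_mul x y : cnorm (cmul x y) <= cnorm x * cnorm y.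
Proof. by rewrite -lecR rmorphM /= !cnormE cnormM. Qed.

Lemma cnorm_half x : cnorm (2^-1 *: x) = cnorm x / 2.
Proof.
apply: (@complexI R); rewrite cnormE normrZ -cnormE rmorphM /= mulrC.
by congr (_ * _); rewrite ger0_norm ?invr_ge0// fmorphV rmorphMn.
Qed.

Lemma cnorm_sq x : cnorm (cmul (cstar x) x) = cnorm x ^+ 2.
Proof. by apply: (@complexI R); rewrite rmorphXn /= !cnormE cnorm_star. Qed.

Lemma cstar0 : cstar (0 : A) = 0.
Proof. by apply: (addrI (cstar 0)); rewrite -cstarD !addr0. Qed.

Lemma cstarN x : cstar (- x) = - cstar x.
Proof. by apply: (addrI (cstar x)); rewrite -cstarD !subrr cstar0. Qed.

Lemma cstarB x y : cstar (x - y) = cstar x - cstar y.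
Proof. by rewrite cstarD cstarN. Qed.

Lemma cmul0l x : cmul 0 x = 0.
Proof. by apply: (addrI (cmul 0 x)); rewrite -cmulDl !addr0. Qed.

Lemma cmul0r x : cmul x 0 = 0.
Proof. by apply: (addrI (cmul x 0)); rewrite -cmulDr !addr0. Qed.

Lemma cmulNl x y : cmul (- x) y = - cmul x y.
Proof. by apply: (addrI (cmul x y)); rewrite -cmulDl !subrr cmul0l. Qed.

Lemma cmulNr x y : cmul x (- y) = - cmul x y.
Proof. by apply: (addrI (cmul x y)); rewrite -cmulDr !subrr cmul0r. Qed.

Lemma cmulBl x y z : cmul (x - y) z = cmul x z - cmul y z.
Proof. by rewrite cmulDl cmulNl. Qed.

Lemma cmulBr x y z : cmul x (y - z) = cmul x y - cmul x z.
Proof. by rewrite cmulDr cmulNr. Qed.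

(** The C*-identity gives |y|^2 <= |y^*| |y|; cancel |y|, then exchange y and y^*. *)
Lemma cnormS x : cnorm (cstar x) = cnorm x.
Proof.
have le_star y : cnorm y <= cnorm (cstar y).
  have [y0|yN0] := eqVneq (cnorm y) 0; first by rewrite y0 cnorm_ge0.
  have y_gt0 : 0 < cnorm y by rewrite lt_neqAle eq_sym yN0 cnorm_ge0.
  by rewrite -(ler_pM2r y_gt0) -expr2 -cnorm_sq cnorm_mul.
apply/eqP; rewrite eq_le le_star andbT.
by move: (le_star (cstar x)); rewrite cstarK.
Qed.

(** * Completeness and a contraction principle *)

Lemma cnorm_cauchy (u : A^nat) :
    (forall e : R, 0 < e ->
      exists N, forall n, (N <= n)%N -> cnorm (u n - u N) < e) ->
  exists l, forall e : R, 0 < e ->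
    exists N, forall n, (N <= n)%N -> cnorm (u n - l) < e.
Proof.
move=> uC; have : cvg (u @ \oo).
  apply/cauchy_cvgP/cauchy_exP => e e_gt0.
  (* A positive element of [R[i]] is real, so real radii suffice. *)
  have eE : e = (complex.Re e)%:C by rewrite RRe_real// gtr0_real.
  have [|N uN] := uC (complex.Re e); first by rewrite -ltcR -eE.
  exists (u N); exists N => // n /= Nn.
  by rewrite -ball_normE /= distrC eE -cnorm_lt uN.
move=> /cvg_ex[l ul]; exists l => e e_gt0.
move/cvgrPdist_lt : ul => /(_ e%:C); rewrite ltcR => /(_ e_gt0)[N _ uN].
by exists N => n Nn; rewrite cnorm_lt distrC uN.
Qed.

(* The library states the Banach fixed-point theorem over a [realType] only,
   while [A] is normed over [R[i]]. *)
Lemma cnorm_fixed_point (T : A -> A) (r : R) :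
    (forall x, cnorm x <= r -> cnorm (T x) <= r) ->
    (forall x y, cnorm x <= r -> cnorm y <= r ->
      cnorm (T x - T y) <= 2^-1 * cnorm (x - y)) ->
  0 <= r -> exists2 x, cnorm x <= r & x = T x.
Proof.
move=> Tr Tlip r_ge0; pose u n := iter n T 0.
have ur n : cnorm (u n) <= r.
  by elim: n => [|n /Tr//]; rewrite /u /= cnorm0.
(* Applying [T] n times shrinks the distance from [u m] to [u 0 = 0], at most [r], by the factor
   [2^-n]; no series of successive gaps is summed. *)
have u1 n m : cnorm (u (n + m)%N - u n) <= (2^-1) ^+ n * r.
  elim: n => [|n ih]; first by rewrite subr0 expr0 mul1r.
  rewrite addSn exprS -mulrA; apply: le_trans (Tlip _ _ (ur _) (ur _)) _.
  by rewrite ler_pM2l.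
have small e : 0 < e -> exists N, forall n, (N <= n)%N -> (2^-1) ^+ n * r < e.
  move=> e_gt0.
  have /cvgrPdist_lt/(_ e e_gt0)[N _ hN] :
      (geometric r (2^-1 : R)) n @[n --> \oo] --> (0 : R).
    by apply: cvg_geometric; rewrite ger0_norm// invf_lt1// ltr1n.
  exists N => n /hN; rewrite /= sub0r normrN mulrC; apply: le_lt_trans.
  exact: ler_norm.
have [e e_gt0|l ul] := @cnorm_cauchy u.
  have [N hN] := small e e_gt0; exists N => n Nn.
  by rewrite -(subnKC Nn); apply: le_lt_trans (u1 _ _) (hN _ _).
have lr : cnorm l <= r.
  apply/ler_addgt0Pr => e e_gt0; have [N /(_ N (leqnn _)) uN] := ul e e_gt0.
  have := cnormB (u N) (u N - l); rewrite subKr; move: (ur N); lra.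
exists l => //; apply/eqP; rewrite -subr_eq0; apply/eqP/cnorm_eq0.
apply/eqP; rewrite eq_le cnorm_ge0 andbT.
apply/ler_addgt0Pr => e e_gt0; rewrite add0r.
have [|N uN] := ul (e / 2); first by rewrite divr_gt0.
have := uN N (leqnn _); have := uN _ (leqnSn N).
have := Tlip _ _ (ur N) lr.
have := cnormB (u N.+1 - T l) (u N.+1 - l); rewrite opprB addrC addrA subrK.
by rewrite -/(u N.+1); have := cnorm_ge0 (u N.+1 - l); lra.
Qed.

(** * Unitaries near 1, written 1 + x without adjoining a unit *)

Local Notation "x ** y" := (cmul x y) (at level 40, left associativity).

(** Since (1 + x)(1 + x)^* = 1, the element (1 + x)^*(1 + x) = 1 + z is a projection, hence so is
    -z, and its norm is 0 or 1. The bound on [x] gives |z| < 1/2 + 1/16, which excludes 1. The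
    fixed-point equation yields unitarity on one side only; this supplies the other side. *)
Lemma quasi_unitary_comm x : x + cstar x + x ** cstar x = 0 ->
  cnorm x < 4^-1 -> x + cstar x + cstar x ** x = 0.
Proof.
move=> xxS x_lt; set z := LHS.
have xz : x ** z = - z.
  apply/eqP; rewrite -subr_eq0 opprK; apply/eqP.
  transitivity (x + cstar x + x ** cstar x
                + (x + cstar x + x ** cstar x) ** x).
    rewrite /z !cmulDl !cmulDr !addrA cmulA.
    by rewrite (ACl (4*5*2*1*6*3))/=.
  by rewrite xxS cmul0l addr0.
have zS : cstar z = z.
  by rewrite /z !cstarD cstarM cstarK (addrC (cstar x)).
have zz : z ** z = - z.
  by rewrite {1}/z !cmulDl -cmulA xz cmulNr addrK.
have z2 : cnorm z ^+ 2 = cnorm z by rewrite -cnorm_sq zS zz cnormN.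
have z1 : cnorm z < 1.
  rewrite /z; have := cnormD (x + cstar x) (cstar x ** x).
  have := cnormD x (cstar x); have := cnorm_mul (cstar x) x.
  rewrite cnormS; have := cnorm_ge0 x; nra.
apply: cnorm_eq0; have := cnorm_ge0 z; nra.
Qed.

Lemma cnorm_mul_le x y (a b : R) :
  cnorm x <= a -> cnorm y <= b -> cnorm (x ** y) <= a * b.
Proof.
by move=> xa yb; apply: le_trans (cnorm_mul x y) _; rewrite ler_pM ?cnorm_ge0.
Qed.

(** * The fixed-point construction of the unitary *)

Section Rotation.
Variables (c e : A) (eta : R).
Hypotheses (cS : cstar c = c) (eS : cstar e = e).
Hypotheses (c1 : cnorm c <= 1) (e_eta : cnorm e <= eta).
(** The tightest demand comes from [T_lip]: the estimates give the factor (6 eta + 72 eta)/2 = 39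
    eta, which has to be at most 1/2. The value 1/100 is a round choice below 1/78. *)
Hypothesis eta100 : eta <= 100^-1.

Let W t := e ** (t + t) - e ** t ** c.
(** The linear part of the affine map [x], so that differences of [x] are values of [P]. *)
Let P t := t + (c ** t - t ** c) + W t.
Let x t := e + P t.
Let T t := - (e + 2^-1 *: (W t + cstar (W t) + cstar (x t) ** x t)).

Let eta_ge0 : 0 <= eta. Proof. exact: le_trans (cnorm_ge0 e) e_eta. Qed.

Let WB t s : W (t - s) = W t - W s.
Proof.
rewrite /W !cmulDr !cmulNr !cmulDl !cmulNl !opprD !opprK !addrA.
by rewrite (ACl (1*3*5*2*4*6))/=.
Qed.

Let PB t s : P (t - s) = P t - P s.
Proof.
rewrite /P WB !cmulBr !cmulBl; move: (W t) (W s) => w v.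
rewrite !opprD !opprK !addrA.
by rewrite (ACl (1*3*5*7*2*4*6*8))/=.
Qed.

Let W_le t : cnorm (W t) <= 3 * eta * cnorm t.
Proof.
have tt := cnormD t t.
have ett := cnorm_mul_le e_eta tt.
have etc : cnorm (e ** t ** c) <= eta * cnorm t * 1.
  exact: cnorm_mul_le (cnorm_mul_le e_eta (lexx _)) c1.
by apply: le_trans (cnormB _ _) _; lra.
Qed.

Let P_le t : cnorm (P t) <= 4 * cnorm t.
Proof.
have ct : cnorm (c ** t) <= 1 * cnorm t := cnorm_mul_le c1 (lexx _).
have tc : cnorm (t ** c) <= cnorm t * 1 := cnorm_mul_le (lexx _) c1.
have ctc := cnormB (c ** t) (t ** c).
have := cnormD (t + (c ** t - t ** c)) (W t).
have := cnormD t (c ** t - t ** c); have := W_le t.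
have : eta * cnorm t <= 100^-1 * cnorm t by rewrite ler_wpM2r// cnorm_ge0.
rewrite -/(P t); have := cnorm_ge0 t; lra.
Qed.

Let x_le t : cnorm t <= 2 * eta -> cnorm (x t) <= 9 * eta.
Proof.
rewrite /x => t_le; have := cnormD e (P t); have := P_le t; move: e_eta; lra.
Qed.

Let T_le t : cnorm t <= 2 * eta -> cnorm (T t) <= 2 * eta.
Proof.
move=> t_le; rewrite /T cnormN.
have xx : cnorm (cstar (x t) ** x t) <= 9 * eta * (9 * eta).
  by rewrite cnorm_mul_le ?cnormS ?x_le.
have := cnormD (W t + cstar (W t)) (cstar (x t) ** x t).
have := cnormD (W t) (cstar (W t)); rewrite cnormS.
have := W_le t.
have := cnormD e (2^-1 *: (W t + cstar (W t) + cstar (x t) ** x t)).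
rewrite cnorm_half; move: xx e_eta t_le eta_ge0 eta100 (cnorm_ge0 t).
nra.
Qed.

Let T_lip t s : cnorm t <= 2 * eta -> cnorm s <= 2 * eta ->
  cnorm (T t - T s) <= 2^-1 * cnorm (t - s).
Proof.
move=> t_le s_le; set u := W (t - s); set v := P (t - s).
(* The quadratic term splits as p^*p - q^*q = p^*(p - q) + (p - q)^*q, with p = [x t] and q =
   [x s]. *)
have -> : T t - T s =
    - (2^-1 *: (u + cstar u + (cstar (x t) ** v + cstar v ** x s))).
  have xv : x t - x s = v by rewrite /v PB /x opprD addrACA subrr add0r.
  rewrite /T; rewrite -xv cmulBr cstarB cmulBl /u WB cstarB.
  rewrite -opprD [- (e + _)]opprD addrACA subrr add0r -scalerBr.
  congr (- (_ *: _)); move: (W t) (W s) => w1 w2.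
  by rewrite !opprD !addrA subrK (ACl (1*4*2*5*3*6))/=.
have vt := P_le (t - s); rewrite -/v in vt.
have xv : cnorm (cstar (x t) ** v) <= 9 * eta * (4 * cnorm (t - s)).
  by rewrite cnorm_mul_le ?cnormS ?x_le.
have vx : cnorm (cstar v ** x s) <= 4 * cnorm (t - s) * (9 * eta).
  by rewrite cnorm_mul_le ?cnormS ?x_le.
rewrite cnormN cnorm_half.
have := cnormD (u + cstar u) (cstar (x t) ** v + cstar v ** x s).
have := cnormD u (cstar u); rewrite cnormS.
have := cnormD (cstar (x t) ** v) (cstar v ** x s).
have := W_le (t - s); rewrite -/u.
have : eta * cnorm (t - s) <= 100^-1 * cnorm (t - s).
  by rewrite ler_wpM2r// cnorm_ge0.
have := cnorm_ge0 (t - s); lra.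
Qed.

(** Here y = x^*, so 1 + y = X^*D + (1 - c)Y^* with D = c + e. If a = ac, the second term is killed
    by [a], and aX^* = a + 2at - act = a + at. *)
Lemma rotation : exists t y : A,
  [/\ cnorm y <= 9 * eta, y + cstar y + y ** cstar y = 0 &
    forall a, a = a ** c -> a + a ** y = (a + a ** t) ** (c + e)].
Proof.
have [|t t_le tT] := cnorm_fixed_point T_le T_lip; first exact: mulr_ge0.
have tS : cstar t = t.
  rewrite tT /T; move: (W t) (x t) => w v.
  rewrite cstarN cstarD cstarZ !cstarD cstarM !cstarK eS (addrC (cstar w)).
  by rewrite conjc_inv conjc_nat.
have xS : cstar (x t) = e + (t + (t ** c - c ** t) + cstar (W t)).
  by rewrite /x /P; move: (W t) => w; rewrite !cstarD cstarN !cstarM tS cS eS.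
exists t, (cstar (x t)); split; first by rewrite cnormS x_le.
- rewrite cstarK.
  have tt : t + t = - (e + e) - (W t + cstar (W t) + cstar (x t) ** x t).
    rewrite {1 2}tT /T -!opprD; congr (- _).
    rewrite addrACA; congr (_ + _).
    by rewrite -scalerDl -div1r -splitr scale1r.
  (* The commutator of the self-adjoint [c] and [t] is skew-adjoint, so it cancels in this sum. *)
  have -> : cstar (x t) + x t = (t + t) + (e + e) + (W t + cstar (W t)).
    rewrite xS /x /P; move: (W t) (cstar (W t)) => w v.
    rewrite -[t ** c - _]opprB; move: (c ** t - t ** c) => k.
    by rewrite !addrA (ACl (7*3*2*6*1*5*8*4))/= subrr add0r.
  by rewrite -addrA addrAC tt subrK addNr.
move=> a ac.
rewrite xS /W cstarB !cstarM cstarD tS cS eS.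
rewrite !cmulDr !cmulNr !cmulDl !cmulDr !cmulA -ac.
by rewrite addrK [a ** t + _]addrC subrK !addrA (ACl (1*3*2*4))/=.
Qed.
End Rotation.

(** * From the interpolating pair c, d to a unitary of the unitization *)

Lemma posball1_star x : posball1 x -> cstar x = x.
Proof. by move=> [[y ->] _]; rewrite cstarM cstarK. Qed.

Lemma ll_d_ll_quasi_unitary a b (eta : R) : posball1 b -> eta <= 100^-1 ->
    (ll_d_ll a b < (eta / 2)%:E)%E ->
  exists y : A, [/\ cnorm y <= 9 * eta, y + cstar y + y ** cstar y = 0,
    y + cstar y + cstar y ** y = 0 & a + a ** y = (a + a ** y) ** b].
Proof.
move=> /posball1_star bS eta100 /ereal_inf_lt[_ /= [delta [_ [c [d cdP]]]] <-].
case: cdP => pc pd ac cd db; rewrite lte_fin => delta_eta.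
have [cS dS] := (posball1_star pc, posball1_star pd).
have [[_ c1] [_ d1]] := (pc, pd).
rewrite /dll in cd.
have dcd_c : cnorm (d ** c ** d - c) <= eta.
  (* Passing from c to cd and then to dcd costs at most |c - cd| each time, hence the [eta / 2] in
     the hypothesis. *)
  have -> : d ** c ** d - c = - ((c - c ** d) + cstar (c - c ** d) ** d).
    by rewrite cstarB cstarM cS dS cmulBl addrA subrK opprB.
  rewrite cnormN; apply: le_trans (cnormD _ _) _.
  have : cnorm (cstar (c - c ** d) ** d) <= cnorm (c - c ** d) * 1.
    by rewrite cnorm_mul_le ?cnormS.
  lra.
have [|t [y [y_le yy ay]]] := rotation cS _ c1 dcd_c eta100.
  by rewrite cstarB !cstarM cS dS cmulA.
exists y; split=> //.
  apply: quasi_unitary_comm => //; move: y_le eta100; lra.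
by rewrite ay // [c + _]addrC subrK !cmulA -[_ ** d ** b]cmulA -db.
Qed.

(** Take u = 1 + y. The first two hypotheses are its unitarity, and the third says that au is fixed
    by right multiplication by [b], which left multiplication by u^* preserves. Then 1 - u = -y. *)
Lemma udist_le a b y : y + cstar y + y ** cstar y = 0 ->
    y + cstar y + cstar y ** y = 0 -> a + a ** y = (a + a ** y) ** b ->
  (udist a b <= (cnorm y)%:E)%E.
Proof.
move=> yyS ySy ay; rewrite /udist /unitary /Atilde.
case: pselect => [unitA|nonunitA].
  case: (cid _) => e eP; have [el er] := (fun x => (eP x).1, fun x => (eP x).2).
  have eS : cstar e = e by rewrite -[LHS]el -{1}[e]cstarK -cstarM el cstarK.
  have aey : a ** (e + y) = a + a ** y by rewrite cmulDr er.
  apply: ereal_inf_lbound; exists (e + y) => /=; last first.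
    by rewrite opprD addNKr cnormN.
  split; last by rewrite -(cmulA (cstar (e + y))) aey {1}ay cmulA.
  rewrite cstarD eS !cmulDl !cmulDr !el !er.
  split; rewrite -[RHS]addr0.
    by rewrite -ySy !addrA.
  by rewrite -yyS !addrA (ACl (1*3*2*4))/=.
have yS1 : unitz_star (y, 1) = (cstar y, 1) by congr (_, _); exact: conjc1.
apply: (@le_trans _ _ (unitz_norm (- y, 0 : R[i]))%:E).
  apply: ereal_inf_lbound; exists (y, 1) => /=; last first.
    by rewrite /=; congr ((unitz_norm (_, _))%:E); rewrite ?sub0r ?subrr.
  rewrite yS1 /unitz_mul /= !mulr1 !mul1r !scale1r !scale0r.
  rewrite ?mulr0 ?mul0r ?cmul0r ?cmul0l ?addr0; split.
    split; congr (_, _).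
      by rewrite -addrA addrC.
    by rewrite -addrA addrC (addrC (cstar y)).
  congr (_, _).
  have -> : (cstar y ** a + a) ** y + (cstar y ** a + a) =
      cstar y ** (a + a ** y) + (a + a ** y).
    by rewrite cmulDl cmulDr cmulA addrACA; congr (_ + _); exact: addrC.
  by rewrite cmulDl -cmulA -ay.
rewrite lee_fin /unitz_norm; apply: ge_sup.
  (* Bounding a [sup] from above requires a nonempty set; the unit ball contains 0. *)
  by exists (cnorm (cmul (- y) 0 + (0 : R[i]) *: 0)), 0 => //=; rewrite cnorm0.
move=> _ [z /= z1 <-]; rewrite scale0r addr0.
by rewrite -(cnormN y) -[leRHS]mulr1 cnorm_mul_le.
Qed.

End CNorm.

Theorem corollary4p2 (R : realType) (A : cstarAlgType R) (eps : R)
    (eps_gt0 : 0 < eps) :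
  exists2 delta : R, 0 < delta &
    forall a b : A, posball1 a -> posball1 b ->
      (ll_d_ll a b < delta%:E)%E -> (udist a b < eps%:E)%E.
Proof.
(* The unitary lies within 9 eta of 1, and 9 eta <= 9 eps / 10 < eps. *)
pose eta := Num.min (100^-1) (eps / 10); exists (eta / 2).
  by rewrite divr_gt0// lt_min invr_gt0 divr_gt0 ?andbT.
move=> a b _ pb /(ll_d_ll_quasi_unitary pb)[|y [y_le yyS ySy ay]].
  by rewrite ge_min lexx.
apply: le_lt_trans (udist_le yyS ySy ay) _; rewrite lte_fin.
have : eta <= eps / 10 by rewrite ge_min lexx orbT.
lra.
Qed.
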